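(* (i) For every integer $d\ge1$ there is a sequence $\eta(n)\ge0$ with $\eta(n)\to0$ as $n\to\infty$ such that, for every sequence of radii $r(n)>0$, if $G\sim G(\mathcal{X}_n;r(n))$ and $G'\sim G(\mathcal{X}_n;r(n)+\eta(n))$ are independent random geometric graphs in $[0,1]^d$, then $\mathbb{P}\{G\subset G'\}\to1$ as $n\to\infty$. (ii) The corresponding result fails for Bernoulli random graphs: if $G\sim\mathcal{G}_{n,1/4}$ and $G'\sim\mathcal{G}_{n,3/4}$ are independent, then $$\mathbb{P}\{G\subset G'\}\le n!\,\exp\left(-\frac{n(n-1)}{32}\right),$$ and hence $\mathbb{P}\{G\subset G'\}\to0$ as $n\to\infty$.
   Context: $G(\mathcal{X}_n;r)$ denotes the random graph whose vertices are $n$ points distributed independently and uniformly in $[0,1]^d$, two distinct points being adjacent iff their Euclidean distance is at most $r$. $\mathcal{G}_{n,p}$ denotes the Bernoulli (Erdős–Rényi) random graph on $n$ vertices, in which each pair of vertices is joined by an edge with probability $p$, independently of all other pairs. $G\subset G'$ means that $G$ is isomorphic to a subgraph of $G'$. *)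

(* Defs.v *)
From HB Require Import structures.
From mathcomp Require Import all_boot all_order all_algebra.
From mathcomp Require Import all_classical all_reals all_analysis.
Import Order.TTheory GRing.Theory Num.Theory.
Import numFieldNormedType.Exports.

Set Implicit Arguments.
Unset Strict Implicit.
Unset Printing Implicit Defensive.

Local Open Scope classical_set_scope.
Local Open Scope ring_scope.

(* An edge {u, v} is encoded by the two ordered pairs (u, v) and (v, u). *)
Definition is_sgraph (V : finType) (E : {set V * V}) : bool :=
  [forall u, (u, u) \notin E] &&
  [forall u, forall v, ((u, v) \in E) == ((v, u) \in E)].

Definition sgraph (V : finType) := {E : {set V * V} | is_sgraph E}.

Definition adj (V : finType) (G : sgraph V) : rel V :=
  fun u v => (u, v) \in val G.

(* (W, F) is a subgraph of H. The graph F is carried by the whole type V, but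
   all its edges have both endpoints in W: vertices outside W are not part of
   the subgraph. *)
Definition is_subgraph (V : finType) (W : {set V}) (F H : sgraph V) : Prop :=
  (forall u v, adj F u v -> u \in W /\ v \in W) /\
  (forall u v, adj F u v -> adj H u v).

Definition isomorphic_to (U V : finType) (G : sgraph U)
    (W : {set V}) (F : sgraph V) : Prop :=
  exists f : U -> V,
    [/\ injective f, f @: [set: U]%SET = W
      & forall u v, adj G u v = adj F (f u) (f v)].

Definition contained (U V : finType) (G : sgraph U) (H : sgraph V) : Prop :=
  exists (W : {set V}) (F : sgraph V),
    is_subgraph W F H /\ isomorphic_to G W F.

Section iid_tuples.
Context d (T : measurableType d) (R : realType).

Definition cons_pair n (x : T * n.-tuple T) : n.+1.-tuple T :=
  [tuple of x.1 :: x.2].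

Lemma measurable_cons_pair n : measurable_fun [set: _] (@cons_pair n).
Proof. exact: measurable_cons. Qed.

HB.instance Definition _ n :=
  isMeasurableFun.Build _ _ _ _ (@cons_pair n) (@measurable_cons_pair n).

(* The law of an n-tuple of independent points with common law P, that is, the
   n-fold product measure P \x ... \x P. *)
Fixpoint iid_prob (P : probability T R) n : probability (n.-tuple T) R :=
  match n with
  | 0 => \d_([tuple] : 0.-tuple T)
  | m.+1 => distribution (P \x iid_prob P m)%E (@cons_pair m)
  end.

End iid_tuples.

Section geometric_graphs.
Context (R : realType) (d n : nat).

Definition point := d.-tuple (measurableTypeR R).

Definition euclidean_dist (x y : point) : R :=
  Num.sqrt (\sum_(k < d) (tnth x k - tnth y k) ^+ 2).

Lemma euclidean_distC x y : euclidean_dist x y = euclidean_dist y x.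
Proof.
rewrite /euclidean_dist; congr (Num.sqrt _).
by apply: eq_bigr => k _; rewrite -sqrrN opprB.
Qed.

Definition uniform_cube : probability point R :=
  iid_prob (uniform_prob (@ltr01 R)) d.

Definition geometric_edges (r : R) (x : n.-tuple point) : {set 'I_n * 'I_n} :=
  [set e | (e.1 != e.2) && (euclidean_dist (tnth x e.1) (tnth x e.2) <= r)]%SET.

Lemma geometric_edges_sgraph r x : is_sgraph (geometric_edges r x).
Proof.
apply/andP; split; first by apply/forallP => i; rewrite inE eqxx.
apply/forallP => i; apply/forallP => j.
by rewrite !inE /= [j == i]eq_sym euclidean_distC.
Qed.

Definition geometric_graph (r : R) (x : n.-tuple point) : sgraph 'I_n :=
  exist _ (geometric_edges r x) (geometric_edges_sgraph r x).

End geometric_graphs.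

Section random_graphs.
Context dT (T : measurableType dT) (R : realType) (P : probability T R).

(* As sgraph V is finite, it is given the discrete sigma-algebra: the events
   are the preimages of arbitrary sets of graphs. *)
Definition random_graph (V : finType) (G : T -> sgraph V) : Prop :=
  forall A : set (sgraph V), measurable (G @^-1` A).

Definition independent_graphs (U V : finType) (G : T -> sgraph U)
    (H : T -> sgraph V) : Prop :=
  forall (A : set (sgraph U)) (B : set (sgraph V)),
    P (G @^-1` A `&` H @^-1` B) = (P (G @^-1` A) * P (H @^-1` B))%E.

Definition independent_events (I : finType) (E : I -> set T) : Prop :=
  forall J : {set I},
    P (\bigcap_(i in [set` J]) E i) = (\prod_(i in J) P (E i))%E.

(* G ~ G(X_n; r) in [0,1]^d: G has the same law as the geometric graph of
   radius r on n independent uniform points of the cube. *)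
Definition random_geometric_graph (d n : nat) (r : R)
    (G : T -> sgraph 'I_n) : Prop :=
  random_graph G /\
  forall A : set (sgraph 'I_n),
    P (G @^-1` A) =
    iid_prob (uniform_cube R d) n (geometric_graph r @^-1` A).

Definition vertex_pair (n : nat) := {e : 'I_n * 'I_n | (e.1 < e.2)%N}.

Definition bernoulli_graph (n : nat) (p : R) (G : T -> sgraph 'I_n) : Prop :=
  let edge (e : vertex_pair n) :=
    [set w | adj (G w) (val e).1 (val e).2] in
  [/\ random_graph G, forall e, P (edge e) = p%:E & independent_events edge].

End random_graphs.

(* Main.v *)
Require Import Defs.
From mathcomp Require Import all_boot all_order all_algebra.
From mathcomp Require Import all_fingroup.
From mathcomp Require Import all_classical all_reals all_analysis.
From mathcomp Require Import measurable_realfun.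
From mathcomp Require Import ring lra zify.
Import Order.TTheory GRing.Theory Num.Theory.
Import numFieldNormedType.Exports.

(** Geometric graphs. Two independent samples of n uniform points of the cube
can, with probability close to 1, be matched one to one so that matched points
are close to each other. If every coordinate moves by at most e, a distance at
most r becomes at most r + 2 d e, so the matching embeds the graph of radius r
of the first sample into the graph of radius r + 2 d e of the second.

To produce the matching, the cube is cut into m ^ d equal cells, numbered by a
boustrophedon (snake) path: cells with consecutive numbers are adjacent
([snake_close]). A sample is balanced when it lies in the cube and, for every k,
the number of its points in the cells 0, ..., k is within n / (2 m ^ d) of its
expectation.
Since every cell has mass at least 1 / m ^ d, for two balanced samples the
points of the first one in the cells 0, ..., k are at most as many as those of
the second one in the cells 0, ..., k + 1, and conversely. Sorting both samples
by cell number and matching the points of equal rank then moves a cell number by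
at most 1 ([matching_exists]), hence a coordinate by at most 2 / m. The
Chebyshev inequality ([chebyshev_count]) shows that a sample fails to be
balanced with probability at most (m ^ d) ^ 3 / n ([balanced_prob]). With m(n)
the largest integer such that m ^ (3 d + 1) <= n, this is at most 1 / m(n),
which tends to 0, and eta(n) = 4 d / m(n) does not depend on the radius.

The argument passes from points to graphs through the laws of the graphs only.
The graphs of radius r of the balanced samples form a set A of graphs, those of
radius r + eta form a set B, every graph of A is contained in every graph of B, and
independence bounds the probability of containment below by the product of the
laws of A and B ([contained_prob_ge]).

Bernoulli graphs. A containment of graphs on the same n vertices is given by one
of the n! permutations. For a fixed permutation, a given pair of vertices
violates the containment with probability 1/4 * 1/4, independently of the other
pairs, so the permutation is an embedding with probability
(15/16) ^ (n (n - 1) / 2), at most exp (- n (n - 1) / 32). The independence hypothesis only concerns the events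
that all the edges of a given set are present; the binomial expansion of
(3/4) ^ |J| = (1 - 1/4) ^ |J| over the subsets of the edge set J of the first
graph reduces the computation to these events ([hom_prob]). The limit follows
from n! <= n ^ n. *)

Set Implicit Arguments.
Unset Strict Implicit.
Unset Printing Implicit Defensive.

Local Open Scope classical_set_scope.
Local Open Scope ring_scope.

(** * Subgraphs *)

Lemma adj_sym (V : finType) (G : sgraph V) u v : adj G u v = adj G v u.
Proof. by have /andP[_ /forallP/(_ u)/forallP/(_ v)/eqP] := valP G. Qed.

Lemma adj_irr (V : finType) (G : sgraph V) u : adj G u u = false.
Proof. by have /andP[/forallP/(_ u)/negbTE] := valP G. Qed.

(** Both directions of the isomorphism with the subgraph are free: the image graph
of an injective homomorphism is a subgraph isomorphic to G. *)
Lemma containedP (U V : finType) (G : sgraph U) (H : sgraph V) :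
  contained G H <->
  exists2 f : U -> V, injective f & forall u v, adj G u v -> adj H (f u) (f v).
Proof.
split=> [[W [F [[_ FH] [f [f_inj _ fE]]]]]|[f f_inj fGH]].
  by exists f => // u v; rewrite fE => /FH.
pose E := [set e : V * V | [exists u, exists v,
  [&& adj G u v, e.1 == f u & e.2 == f v]]]%SET.
have EP u v : ((f u, f v) \in E) = adj G u v.
  rewrite inE; apply/existsP/idP => [[u' /existsP[v' /and3P[uv /= /eqP]]]|uv].
    by move=> /f_inj-> /eqP/f_inj->.
  by exists u; apply/existsP; exists v; rewrite uv !eqxx.
have E_sgraph : is_sgraph E.
  apply/andP; split; apply/forallP => u.
    rewrite inE; apply/existsP => -[a /existsP[b /and3P[ab /= /eqP-> /eqP/f_inj]]].
    by move=> eab; rewrite eab adj_irr in ab.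
  apply/forallP => v; apply/eqP; rewrite !inE.
  by apply/existsP/existsP => -[a /existsP[b /and3P[ab /= e1 e2]]];
    exists b; apply/existsP; exists a; rewrite adj_sym ab e1 e2.
exists (f @: [set: U]%SET), (exist _ E E_sgraph); split; last first.
  by exists f; split=> // u v; rewrite /adj /= EP.
split=> u v; rewrite /adj /= inE => /existsP[a /existsP[b /and3P[ab]]];
  move=> /= /eqP-> /eqP->.
  by rewrite !imset_f ?inE.
exact: fGH.
Qed.

(** * The snake path through a grid *)

Section snake_path.
Local Open Scope nat_scope.

(** The number of the cell with coordinates [s], each below [m], along the path
that runs through the slices of first coordinate 0, 1, 2, ... in this order and
traverses every slice of odd first coordinate backwards. *)
Fixpoint snake (m : nat) (s : seq nat) : nat :=
  if s is j :: t then
    j * m ^ size t +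
    (if odd j then (m ^ size t).-1 - snake m t else snake m t)
  else 0.

Lemma snake_lt m s : all (gtn m) s -> snake m s < m ^ size s.
Proof.
elim: s => //= j s IH /andP[jm /IH lt].
have : j.+1 * m ^ size s <= m * m ^ size s by rewrite leq_mul2r jm orbT.
rewrite expnS mulSn; case: ifP => _; lia.
Qed.

(** The case k = 0 is the injectivity of the numbering, the case k = 1 says that
the path has no jumps. They are proved together: between the end of a slice and
the beginning of the next one, the reversal of the odd slices makes the numbers
of the remaining coordinates coincide, so that case 0 applies to them. *)
Lemma snake_close m s t k : k <= 1 -> size s = size t ->
  all (gtn m) s -> all (gtn m) t ->
  snake m s <= snake m t + k -> snake m t <= snake m s + k ->
  forall i, nth 0 s i <= nth 0 t i + k.
Proof.
elim: s t k => [|a s IH] [|b t] //= k k1.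
  by move=> _ _ _ _ _ i; rewrite nth_nil.
case=> sz /andP[am sm] /andP[bm tm].
have {IH} IH k' : k' <= 1 -> snake m s <= snake m t + k' ->
    snake m t <= snake m s + k' -> forall i, nth 0 s i <= nth 0 t i + k'.
  by move=> ? ? ?; apply: IH.
have := snake_lt sm; have := snake_lt tm; rewrite -sz.
set M := m ^ size s; move: (snake m s) (snake m t) IH => x y IH yM xM h1 h2.
have IH0 : x = y -> forall i, nth 0 s i <= nth 0 t i + k.
  by move=> xy i; rewrite (leq_trans (IH 0 _ _ _ i)) ?xy ?addn0 ?leq_addr.
case: (ltngtP a b) => ab.
(* Distinct slices: the path is at the turn from one to the next, which leaves the
   remaining coordinates unchanged. *)
- have e : a.+1 * M <= b * M by rewrite leq_mul2r ab orbT.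
  case: (leqP b a.+1) => ba; last first.
    have : a.+2 * M <= b * M by rewrite leq_mul2r ba orbT.
    by move: h1 h2; rewrite !mulSn; do 2!case: ifP => _; lia.
  have {ab ba e} eb : b = a.+1 by lia.
  move: h1 h2; rewrite {}eb /= mulSn; case: (odd a) => /= h1 h2.
    have xy : x = y by lia.
    by case=> [|i] /=; [lia|exact: IH0].
  have xy : x = y by lia.
  by case=> [|i] /=; [lia|exact: IH0].
- have e : b.+1 * M <= a * M by rewrite leq_mul2r ab orbT.
  case: (leqP a b.+1) => ba; last first.
    have : b.+2 * M <= a * M by rewrite leq_mul2r ba orbT.
    by move: h1 h2; rewrite !mulSn; do 2!case: ifP => _; lia.
  have {ab ba e} eb : a = b.+1 by lia.
  move: h1 h2; rewrite {}eb /= mulSn; case: (odd b) => /= h1 h2.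
    have xy : x = y by lia.
    by case=> [|i] /=; [lia|exact: IH0].
  have xy : x = y by lia.
  by case=> [|i] /=; [lia|exact: IH0].
- move: h1 h2; rewrite ab; case: ifP => _ h1 h2; case=> [|i] /=; try lia;
    apply: IH => //; lia.
Qed.

Lemma snake_surj m d k : k < m ^ d ->
  exists s, [/\ size s = d, all (gtn m) s & snake m s = k].
Proof.
elim: d k => [|d IH] k; first by rewrite expn0 ltnS leqn0 => /eqP->; exists [::].
rewrite expnS => km.
have M0 : 0 < m ^ d by case: (m ^ d) km => //; rewrite muln0.
have rM : k %% m ^ d < m ^ d by rewrite ltn_mod.
have qm : k %/ m ^ d < m by rewrite ltn_divLR.
have [|s [sz sm sE]] := IH (if odd (k %/ m ^ d) then (m ^ d).-1 - k %% m ^ d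
    else k %% m ^ d); first by case: ifP => _; lia.
exists (k %/ m ^ d :: s); split => /=; first by rewrite sz.
  by rewrite qm.
rewrite sz sE [RHS](divn_eq k (m ^ d)); congr (_ + _).
case: (odd _) => //; rewrite subKn //; lia.
Qed.

End snake_path.

(** * Matching two families by rank *)

Section rank_matching.
Local Open Scope nat_scope.

Lemma sorted_nth_count (T : eqType) (r : rel T) (p : pred T) (x0 : T) (l : seq T) j :
  transitive r -> (forall x y, r x y -> p y -> p x) ->
  sorted r l -> j < size l -> p (nth x0 l j) = (j < count p l).
Proof.
move=> r_tr p_r; elim: l j => //= x l IH j xl.
have npx : ~~ p x -> count p l = 0.
  move=> px; apply/eqP; rewrite -leqn0 leqNgt -has_count.
  apply/hasPn => y yl; apply: contra px; apply: p_r.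
  exact: (allP (order_path_min r_tr xl)).
case: (boolP (p x)) => px; case: j => [|j] //= jl.
- by rewrite IH ?(path_sorted xl).
- by rewrite (npx px); apply/negbTE.
- by rewrite IH ?(path_sorted xl) // (npx px).
Qed.

(** The right-hand side depends only on how many keys are at most [k], which is
what allows the comparison of two sorted families. *)
Lemma sorting_perm n (key : 'I_n -> nat) : exists s : {perm 'I_n},
  forall j k, (key (s j) <= k) = (j < #|[pred i | key i <= k]|).
Proof.
pose l := sort (relpre key leq) (enum 'I_n).
have sz : size l = n by rewrite size_sort size_enum_ord.
have lu : uniq l by rewrite sort_uniq enum_uniq.
pose f (j : 'I_n) := nth j l j.
have f_inj : injective f.
  move=> i j; rewrite /f (set_nth_default j) ?sz // => /eqP.
  by rewrite nth_uniq ?sz // => /eqP/val_inj.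
exists (perm f_inj) => j k; rewrite permE /f.
rewrite (@sorted_nth_count _ (relpre key leq) (fun i => key i <= k)) ?sz //.
- by rewrite count_sort cardE size_filter enumT.
- by move=> x y z /=; apply: leq_trans.
- by move=> x y /=; apply: leq_trans.
- by apply: sort_sorted => x y /=; apply: leq_total.
Qed.

(** The indices of equal rank in the two families are matched. If the element of
rank j has key k in one family, more than j keys of that family are at most k,
hence more than j keys of the other one are at most k + 1, and so is its key of
rank j. *)
Lemma matching_exists n (key key' : 'I_n -> nat) :
  (forall k, #|[pred i | key i <= k]| <= #|[pred i | key' i <= k.+1]|) ->
  (forall k, #|[pred i | key' i <= k]| <= #|[pred i | key i <= k.+1]|) ->
  exists2 f : 'I_n -> 'I_n, injective f &
    forall i, key i <= (key' (f i)).+1 /\ key' (f i) <= (key i).+1.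
Proof.
move=> h h'; have [s sP] := sorting_perm key; have [s' sP'] := sorting_perm key'.
exists (fun i => s' ((s^-1)%g i)).
  by move=> i j /perm_inj/perm_inj.
move=> i; rewrite -{1 4}(permKV s i); set j := ((s^-1)%g i).
split.
  by rewrite sP (leq_trans _ (h' _)) // -sP'.
by rewrite sP' (leq_trans _ (h _)) // -sP.
Qed.

End rank_matching.

(** * Measurability and counts for independent samples *)

Lemma measurable_fibers d (T : measurableType d) (V : countType) (g : T -> V) :
  (forall v, measurable (g @^-1` [set v])) ->
  forall A : set V, measurable (g @^-1` A).
Proof.
move=> mg A.
pose F n := if unpickle n is Some v then
  (if v \in A then g @^-1` [set v] else set0) else set0.
have -> : g @^-1` A = \bigcup_n F n.
  apply/seteqP; split=> x /=.
    by move=> Ax; exists (pickle (g x)); rewrite // /F pickleK mem_set.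
  move=> [n _]; rewrite /F; case: unpickle => // v.
  by case: ifP => // /set_mem Av /= ->.
apply: bigcup_measurable => n _; rewrite /F; case: unpickle => // v.
by case: ifP.
Qed.

(** Every event that depends only on finitely many basic events is measurable. *)
Lemma measurable_bool_family d (T : measurableType d) (I : finType)
    (p : I -> T -> bool) (B : set {ffun I -> bool}) :
  (forall i, measurable [set x | p i x]) ->
  measurable [set x | B [ffun i => p i x]].
Proof.
move=> mp; apply: (@measurable_fibers _ _ _ (fun x => [ffun i => p i x])) => v.
have -> : (fun x => [ffun i => p i x]) @^-1` [set v] =
    \bigcap_(i in [set: I]) [set x | p i x = v i].
  apply/seteqP; split=> [x <- i _|x h] /=; first by rewrite ffunE.
  by apply/ffunP => i; rewrite ffunE h.
apply: fin_bigcap_measurable => [|i _]; first exact: finite_finset.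
case: (v i); first exact: mp.
have -> : [set x | p i x = false] = ~` [set x | p i x].
  by apply/seteqP; split=> x /=; [move=> -> | move/negP/negbTE].
exact/measurableC/mp.
Qed.

Section iid.
Context d (T : measurableType d) (R : realType) (P : probability T R).

Lemma measurable_tnth_pred n (p : pred T) (i : 'I_n) :
  measurable [set x | p x] -> measurable [set t : n.-tuple T | p (tnth t i)].
Proof.
by move=> mp; rewrite -[X in measurable X]setTI; exact: (measurable_tnth i measurableT mp).
Qed.

Lemma card_tnth_count n (p : pred T) (t : n.-tuple T) :
  #|[pred i | p (tnth t i)]| = count p t.
Proof.
rewrite cardE size_filter -enumT -[in RHS](map_tnth_enum t) count_map.
exact: eq_count.
Qed.

Lemma measurable_count n (p : pred T) (B : set nat) :
  measurable [set x | p x] -> measurable [set t : n.-tuple T | B (count p t)].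
Proof.
move=> mp.
have -> : [set t : n.-tuple T | B (count p t)] =
   [set t | [set f : {ffun 'I_n -> bool} | B #|[pred i | f i]|]
     [ffun i => p (tnth t i)]].
  apply/seteqP; split=> t /=; rewrite -card_tnth_count;
    by congr (B _); apply: eq_card => i; rewrite !inE ffunE.
by apply: measurable_bool_family => i; apply: measurable_tnth_pred.
Qed.

Lemma iid_probS n (S : set (n.+1.-tuple T)) :
  iid_prob P n.+1 S = (P \x iid_prob P n)%E (@cons_pair _ T n @^-1` S).
Proof. by []. Qed.

Lemma measurable_box n (B : nat -> set T) : (forall i, measurable (B i)) ->
  measurable [set t : n.-tuple T | forall i : 'I_n, B i (tnth t i)].
Proof.
move=> mB.
have -> : [set t : n.-tuple T | forall i : 'I_n, B i (tnth t i)] =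
   \bigcap_(i in [set: 'I_n]) ((@tnth n T ^~ i) @^-1` B i).
  by apply/seteqP; split=> t /= h i; [move=> _; exact: h|exact: (h i I)].
apply: fin_bigcap_measurable => [|i _]; first exact: finite_finset.
by rewrite -[X in measurable X]setTI; exact: (measurable_tnth i measurableT).
Qed.

Lemma iid_box n (B : nat -> set T) : (forall i, measurable (B i)) ->
  iid_prob P n [set t | forall i : 'I_n, B i (tnth t i)] =
  (\prod_(i < n) P (B i))%E.
Proof.
elim: n B => [|n IH] B mB.
  rewrite big_ord0 /= diracE mem_set //; by case.
rewrite big_ord_recl -(IH (fun i => B i.+1)) // -product_measure1E //.
  rewrite iid_probS; congr (product_measure1 _ _ _).
  apply/seteqP; split=> -[x t] /=.
    move=> h; split; first exact: (h ord0).
    by move=> i; have := h (lift ord0 i); rewrite tnthS.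
  move=> [h0 h] i; case: (unliftP ord0 i) => [j|] -> //.
  by rewrite /cons_pair /= tnthS.
exact: (measurable_box (B := fun i => B i.+1)).
Qed.

(** The second moment of the shifted count is c ^ 2 + n q (1 - q). The shift c makes
the Chebyshev bound provable by induction on n: splitting according to the
first point replaces c by c + 1 - q with probability q and by c - q with
probability 1 - q, and the bounds average to the one for n + 1. *)
Lemma chebyshev_count_shift (p : pred T) (q L : R) n (c : R) :
  measurable [set x | p x] -> P [set x | p x] = q%:E -> 0 < L ->
  (iid_prob P n [set t | (L <= `|(count p t)%:R - n%:R * q + c|)%R]
    <= ((c ^+ 2 + n%:R * q * (1 - q)) / L ^+ 2)%:E)%E.
Proof.
move=> mp Pq L0; have L20 : 0 < L ^+ 2 by rewrite exprn_gt0.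
elim: n c => [|n IH] c.
  rewrite /= diracE; case: (boolP (_ \in _)) => [/set_mem /=|_].
    rewrite !mul0r subr0 add0r addr0 lee_fin ler_pdivlMr // mul1r => h.
    by rewrite -[c ^+ 2]real_normK ?num_real // lerXn2r ?nnegrE ?(ltW L0).
  by rewrite lee_fin !mul0r addr0 divr_ge0 ?sqr_ge0 // ltW.
pose S k b := [set t : k.-tuple T | L <= `|(count p t)%:R - k%:R * q + b|].
have mS k b : measurable (S k b).
  by apply: (@measurable_count _ p [set j | L <= `|j%:R - k%:R * q + b|]).
have q0 : 0 <= q by rewrite -lee_fin -Pq measure_ge0.
have q1 : q <= 1 by rewrite -lee_fin -Pq probability_le1.
have -> : iid_prob P n.+1 (S n.+1 c) = (P \x iid_prob P n)%E
   (([set x | p x] `*` S n (c + (1 - q))) `|`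
    (~` [set x | p x] `*` S n (c - q))).
  rewrite iid_probS; congr (product_measure1 _ _ _).
  have E1 k : (true + k)%:R - n.+1%:R * q + c = k%:R - n%:R * q + (c + (1 - q)).
    rewrite -[(true + k)%N]/k.+1 -!natr1; ring.
  have E0 k : (false + k)%:R - n.+1%:R * q + c = k%:R - n%:R * q + (c - q).
    rewrite -[(false + k)%N]/k -natr1; ring.
  suff H x t : (S n.+1 c) (cons_pair (x, t)) <-> (p x /\ S n (c + (1 - q)) t) \/
      (~ p x /\ S n (c - q) t).
    by apply/seteqP; split=> -[x t] /= /H.
  rewrite /S /=.
  case: (boolP (p x)) => px.
    rewrite E1; split=> [h|]; first by left.
    by case=> -[].
  rewrite E0; split=> [h|]; first by right; split=> //; apply/negP.
  by case=> -[]; rewrite ?(negbTE px).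
rewrite measureU; last 3 first.
- by apply: measurableX => //; exact: mS.
- by apply: measurableX; [exact: measurableC|exact: mS].
- by apply/seteqP; split=> // -[x t] /= [[px _] [npx _]].
have e1 := product_measure1E P (iid_prob P n) mp (mS n (c + (1 - q))).
have e2 := product_measure1E P (iid_prob P n) (measurableC mp) (mS n (c - q)).
rewrite [X in (X + _ <= _)%E]e1 [X in (_ + X <= _)%E]e2.
have PC : P (~` [set x | p x]) = (1 - q)%:E by rewrite probability_setC // Pq.
rewrite [X in (X * _ + _ <= _)%E]Pq [X in (_ + X * _ <= _)%E]PC.
apply: (@le_trans _ _ (q%:E * (((c + (1 - q)) ^+ 2 + n%:R * q * (1 - q)) / L ^+ 2)%:E
  + (1 - q)%:E * (((c - q) ^+ 2 + n%:R * q * (1 - q)) / L ^+ 2)%:E)%E).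
  by apply: leeD; apply: lee_wpmul2l; rewrite ?lee_fin ?subr_ge0 //; apply: IH.
rewrite -!EFinM -EFinD lee_fin !mulrA -mulrDl ler_pM2r ?invr_gt0 //.
rewrite le_eqVlt; apply/orP; left; apply/eqP; rewrite -natr1; ring.
Qed.

Lemma chebyshev_count (p : pred T) (q L : R) n :
  measurable [set x | p x] -> P [set x | p x] = q%:E -> 0 < L ->
  (iid_prob P n [set t | (L <= `|(count p t)%:R - n%:R * q|)%R]
    <= (n%:R * q * (1 - q) / L ^+ 2)%:E)%E.
Proof.
move=> mp Pq L0; have := chebyshev_count_shift n 0 mp Pq L0.
rewrite expr0n /= add0r; apply: le_trans.
rewrite [X in (iid_prob P n X <= _)%E](_ : _ = [set t : n.-tuple T |
  (L <= `|(count p t)%:R - n%:R * q + 0|)%R]) //.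
by apply/seteqP; split=> t /=; rewrite addr0.
Qed.

End iid.

(** * Cells of the unit cube *)

Section cells.
Variable R : realType.
Implicit Types (x y : R) (m : nat).

(** The minimum puts the end point 1 into the last cell. *)
Definition cell m x : nat := minn (Num.truncn (m%:R * x)) m.-1.

Lemma cell_lt m x : (0 < m)%N -> (cell m x < m)%N.
Proof. by move=> m0; rewrite /cell; lia. Qed.

Lemma cell_itv m x : (0 < m)%N -> 0 <= x <= 1 ->
  (cell m x)%:R <= m%:R * x <= (cell m x).+1%:R.
Proof.
move=> m0 /andP[x0 x1]; have mx0 : 0 <= m%:R * x by rewrite mulr_ge0.
have mxm : m%:R * x <= m%:R by rewrite ler_piMr.
have /andP[lo up] := truncn_itv mx0.
apply/andP; split.
  by rewrite (le_trans _ lo) // ler_nat /cell geq_minl.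
rewrite /cell; case: leqP => _; first exact: ltW.
by rewrite prednK.
Qed.

Lemma cellE m x j : (j < m)%N -> j%:R <= m%:R * x < j.+1%:R -> cell m x = j.
Proof.
move=> jm /andP[h1 h2]; have mx0 : 0 <= m%:R * x by rewrite (le_trans _ h1).
suff : Num.truncn (m%:R * x) = j by rewrite /cell => ->; lia.
by apply/truncn_def => //; rewrite h1 h2.
Qed.

(** The coordinate of the cell is monotone, so its level sets are intervals. *)
Lemma measurable_cell m (A : set nat) : measurable [set x | A (cell m x)].
Proof.
apply: (@measurable_fibers _ (measurableTypeR R) _ (cell m)) => v.
apply: is_interval_measurable => x y /= xv yv z /andP[xz zy].
have mono : {homo cell m : a b / a <= b >-> (a <= b)%N}.
  move=> a b ab; rewrite /cell.
  have : (Num.truncn (m%:R * a) <= Num.truncn (m%:R * b))%N.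
    by apply: le_truncn; rewrite ler_wpM2l.
  lia.
by apply/eqP; rewrite eqn_leq -{1}yv -xv !mono.
Qed.

Notation U01 := (uniform_prob (@ltr01 R)).

Lemma uniform_prob_itv (A : set R) : measurable A -> A `<=` `[0, 1] ->
  U01 A = lebesgue_measure A.
Proof.
move=> mA A01; rewrite /uniform_prob.
rewrite (eq_integral (fun=> 1%E)); first by rewrite integral_cst // mul1e.
move=> x /set_mem/A01 /=; rewrite in_itv /= /uniform_pdf => ->.
by rewrite subr0 invr1.
Qed.

Lemma unit_itvE : [set y : R | 0 <= y <= 1] = `[0, 1]%classic.
Proof. by apply/seteqP; split=> x /=; rewrite in_itv. Qed.

Lemma measurable_unit_itv :
  measurable [set y : measurableTypeR R | 0 <= y <= 1].
Proof. by rewrite unit_itvE; exact: measurable_itv. Qed.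

Lemma uniform_unit_itv : U01 `[0, 1] = 1%E.
Proof.
rewrite uniform_prob_itv // lebesgue_measure_itv /= lte_fin ltr01.
by rewrite oppr0 adde0.
Qed.

Lemma uniform_cell m j : (j < m)%N ->
  ((m%:R^-1)%:E <= U01 [set x | cell m x = j])%E.
Proof.
move=> jm; have m0 : 0 < m%:R :> R by rewrite ltr0n; lia.
have sub : `[(j%:R / m%:R : R), (j.+1%:R / m%:R)[ `<=` [set x | cell m x = j].
  move=> x /=; rewrite in_itv /= ler_pdivrMr // ltr_pdivlMr // => h.
  by apply: cellE => //; rewrite mulrC.
have sub1 : `[(j%:R / m%:R : R), (j.+1%:R / m%:R)[ `<=` `[0, 1].
  move=> x /=; rewrite !in_itv /= => /andP[h1 h2].
  rewrite (le_trans _ h1) ?divr_ge0 //= (le_trans (ltW h2)) //.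
  by rewrite ler_pdivrMr // mul1r ler_nat.
rewrite (@le_trans _ _ (U01 `[(j%:R / m%:R : R), (j.+1%:R / m%:R)[)) //.
  2: by apply: le_measure => //; rewrite inE //; exact: (@measurable_cell m [set j]).
rewrite (uniform_prob_itv _ sub1) // lebesgue_measure_itv /= lte_fin.
rewrite ltr_pM2r ?invr_gt0 // ltr_nat ltnSn -EFinB lee_fin -mulrBl.
by rewrite -natr1 addrAC subrr add0r mul1r.
Qed.

Variable d : nat.

Definition snake_cell m (x : Defs.point R d) : nat := snake m [seq cell m c | c <- x].

Lemma snake_cell_lt m (x : Defs.point R d) : (0 < m)%N -> (snake_cell m x < m ^ d)%N.
Proof.
move=> m0; rewrite -[X in (_ ^ X)%N](size_tuple x) -(size_map (cell m)).
by apply: snake_lt; apply/allP => _ /mapP[c _ ->]; rewrite /= cell_lt.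
Qed.

Lemma measurable_snake_cell m (A : set nat) :
  measurable [set x : Defs.point R d | A (snake_cell m x)].
Proof.
apply: (@measurable_fibers _ _ _ (fun x : Defs.point R d => [seq cell m c | c <- x])
  _ [set s | A (snake m s)]) => s.
case: (eqVneq (size s) d) => sd; last first.
  rewrite (_ : _ @^-1` _ = set0) //; apply/seteqP; split=> x //= xs.
  by move: sd; rewrite -xs size_map size_tuple eqxx.
have -> : (fun x : Defs.point R d => [seq cell m c | c <- x]) @^-1` [set s] =
    \bigcap_(i in [set: 'I_d])
      ((@tnth d _ ^~ i) @^-1` [set x | cell m x = nth 0%N s i]).
  apply/seteqP; split=> x /=.
    by move=> <- i _ /=; rewrite (nth_map 0) ?size_tuple // -tnth_nth.
  move=> h; apply: (@eq_from_nth _ 0%N); rewrite size_map size_tuple // => i id.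
  by rewrite (nth_map 0) ?size_tuple // -(h (Ordinal id) I) (tnth_nth 0).
apply: fin_bigcap_measurable => [|i _]; first exact: finite_finset.
rewrite -[X in measurable X]setTI; apply: (measurable_tnth i measurableT).
exact: (@measurable_cell m [set nth 0%N s i]).
Qed.

(** The path visits every cell, and a cell is a product of d intervals of mass at
least 1 / m. *)
Lemma uniform_cube_snake_cell m k : (k < m ^ d)%N ->
  (((m ^ d)%:R^-1)%:E <= uniform_cube R d [set x | snake_cell m x = k])%E.
Proof.
move=> /snake_surj[s [sd sm sk]].
have sub : [set x : Defs.point R d | forall i : 'I_d,
    [set y | cell m y = nth 0%N s i] (tnth x i)] `<=` [set x | snake_cell m x = k].
  move=> x /= h; rewrite /snake_cell -sk; congr snake.
  apply: (@eq_from_nth _ 0%N); rewrite size_map size_tuple // => i id.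
  by rewrite (nth_map 0) ?size_tuple // -(h (Ordinal id)) (tnth_nth 0).
have mB i : measurable [set y : measurableTypeR R | cell m y = nth 0%N s i].
  exact: (@measurable_cell m [set nth 0%N s i]).
have box := iid_box U01 d mB.
rewrite (@le_trans _ _ (\prod_(i < d) U01 [set y | cell m y = nth 0%N s i])%E) //.
  2: { rewrite -box; apply: le_measure => //; rewrite inE.
    exact: (measurable_box mB).
  exact: (@measurable_snake_cell m [set k]). }
rewrite natrX -exprVn.
have sizes i : (i < d)%N -> (nth 0%N s i < m)%N.
  by move=> id; apply: (allP sm); rewrite mem_nth ?sd.
elim: d sizes => [|e IH] sizes; first by rewrite big_ord0 expr0.
rewrite big_ord_recr /= exprSr EFinM lee_pmul ?lee_fin ?exprn_ge0 ?invr_ge0 //.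
  by apply: IH => i ie; apply: sizes; apply: ltnW.
exact: (uniform_cell (sizes _ (ltnSn e))).
Qed.

Lemma uniform_cube_unit :
  uniform_cube R d [set x | forall i : 'I_d, 0 <= tnth x i <= 1] = 1%E.
Proof.
rewrite /uniform_cube (iid_box _ _ (fun=> measurable_unit_itv)) big1 // => i _.
by rewrite unit_itvE; exact: uniform_unit_itv.
Qed.

Lemma measurable_unit_cube :
  measurable [set x : Defs.point R d | forall i : 'I_d, 0 <= tnth x i <= 1].
Proof.
exact: (measurable_box (fun=> measurable_unit_itv)).
Qed.

Lemma snake_cell_close m (x y : Defs.point R d) : (0 < m)%N ->
  (forall i, 0 <= tnth x i <= 1) -> (forall i, 0 <= tnth y i <= 1) ->
  (snake_cell m x <= (snake_cell m y).+1)%N ->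
  (snake_cell m y <= (snake_cell m x).+1)%N ->
  forall i, `|tnth x i - tnth y i| <= 2 / m%:R.
Proof.
move=> m0 x01 y01 xy yx i.
have cells_lt (z : Defs.point R d) : all (gtn m) [seq cell m c | c <- z].
  by apply/allP => _ /mapP[c _ ->] /=; apply: cell_lt.
have close (z t : Defs.point R d) : (snake_cell m z <= (snake_cell m t).+1)%N ->
    (snake_cell m t <= (snake_cell m z).+1)%N ->
    (cell m (tnth z i) <= (cell m (tnth t i)).+1)%N.
  move=> zt tz; rewrite !(tnth_nth 0) -!(nth_map 0 0%N (cell m)) ?size_tuple //.
  by rewrite -addn1; apply: (@snake_close m) => //; rewrite ?size_map ?size_tuple ?addn1.
have h5 := close _ _ xy yx; have h6 := close _ _ yx xy.
move: (cell_itv m0 (x01 i)) (cell_itv m0 (y01 i)).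
move: h5 h6; set a := tnth x i; set b := tnth y i.
set j := cell m a; set k := cell m b.
rewrite -!(ler_nat R) -!natr1 => h5 h6 /andP[h1 h2] /andP[h3 h4].
have mR : 0 < m%:R :> R by rewrite ltr0n.
rewrite ler_pdivlMr // mulrC -[m%:R]ger0_norm ?ler0n // -normrM mulrBr ler_norml.
by apply/andP; split; lra.
Qed.
End cells.

(** * Euclidean distances *)

Section distance.
Variables (R : realType) (d : nat).

Lemma sqrtr_le (a r : R) : 0 <= r -> (Num.sqrt a <= r) = (a <= r ^+ 2).
Proof. by move=> r0; rewrite -{1}[r]ger0_norm // -sqrtr_sqr ler_sqrt ?sqr_ge0. Qed.

Lemma measurable_dist_le (n : nat) (i j : 'I_n) (r : R) : 0 <= r ->
  measurable [set t : n.-tuple (Defs.point R d) |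
    euclidean_dist (tnth t i) (tnth t j) <= r].
Proof.
move=> r0; rewrite /euclidean_dist.
have -> : [set t : n.-tuple (Defs.point R d) |
    Num.sqrt (\sum_(k < d) (tnth (tnth t i) k - tnth (tnth t j) k) ^+ 2) <= r] =
    (fun t : n.-tuple (Defs.point R d) =>
    (\sum_(k < d) (tnth (tnth t i) k - tnth (tnth t j) k) ^+ 2 : R))
       @^-1` `]-oo, r ^+ 2].
  by apply/seteqP; split=> t /=; rewrite in_itv /= sqrtr_le.
rewrite -[X in measurable X]setTI.
have m1 l k : measurable_fun [set: n.-tuple (Defs.point R d)]
    (fun t => tnth (tnth t l) k : measurableTypeR R).
  apply: (measurableT_comp (measurable_tnth k)); exact: measurable_tnth.
apply: (_ : measurable_fun setT _) => //.
apply: measurable_sum => k; apply: measurable_funX.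
by apply: measurable_funB; exact: m1.
Qed.

(** A coordinate of x - y is at most r and changes by at most 2 e, so its square
grows by at most 2 r (2 e) + (2 e) ^ 2. Summing over the d coordinates gives at
most (r + 2 d e) ^ 2, because d <= d ^ 2. *)
Lemma dist_perturb (x y x' y' : Defs.point R d) (r e : R) :
  (0 < d)%N -> 0 <= r -> 0 <= e ->
  (forall i, `|tnth x i - tnth x' i| <= e) ->
  (forall i, `|tnth y i - tnth y' i| <= e) ->
  euclidean_dist x y <= r -> euclidean_dist x' y' <= r + d%:R * (2 * e).
Proof.
move=> d0 r0 e0 xx yy.
have dR : 1 <= d%:R :> R by rewrite ler1n.
rewrite /euclidean_dist sqrtr_le // => xy.
have re0 : 0 <= r + d%:R * (2 * e) by rewrite addr_ge0 // !mulr_ge0.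
rewrite sqrtr_le //.
have bound k : (tnth x' k - tnth y' k) ^+ 2 <=
    (tnth x k - tnth y k) ^+ 2 + (2 * r * (2 * e) + (2 * e) ^+ 2).
  have : `|tnth x k - tnth y k| <= r.
    rewrite -[r]ger0_norm // -ler_sqr ?nnegrE // !real_normK ?num_real //.
    apply: le_trans xy; rewrite (bigD1 k) //= lerDl.
    by apply: sumr_ge0 => l _; rewrite sqr_ge0.
  move: (xx k) (yy k); rewrite !ler_norml.
  set a := tnth x k; set b := tnth y k; set a' := tnth x' k; set b' := tnth y' k.
  move=> /andP[h1 h2] /andP[h3 h4] /andP[h5 h6].
  have -> : a' - b' = (a - b) + ((a' - a) - (b' - b)) by ring.
  set u := a - b in h5 h6 *; set v := (a' - a) - (b' - b).
  have h7 : - (2 * e) <= v by rewrite /v; lra.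
  have h8 : v <= 2 * e by rewrite /v; lra.
  rewrite sqrrD -addrA lerD2l lerD //; last first.
    by rewrite -ler_sqrt ?sqr_ge0 // !sqrtr_sqr [leRHS]ger0_norm ?mulr_ge0 // ler_norml h7 h8.
  have uv : u * v <= r * (2 * e).
    rewrite (le_trans (ler_norm _)) // normrM.
    by rewrite ler_pM // ler_norml ?h5 ?h6 ?h7 ?h8.
  by rewrite -[_ *+ 2]mulr_natl -mulrA ler_pM2l.
apply: le_trans (ler_sum _ (fun k _ => bound k)) _.
rewrite big_split /= sumr_const card_ord.
apply: le_trans (lerD xy (lexx _)) _.
rewrite -mulr_natl; nra.
Qed.
End distance.

(** * Balanced samples *)

Section good.
Variables (R : realType) (d : nat) (n m : nat).
Local Notation pt := (Defs.point R d).

Definition snake_cdf (k : nat) : R :=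
  fine (uniform_cube R d [set x | (snake_cell m x <= k)%N]).

(** The tolerance is half the smallest possible mass n / m ^ d of a cell, so that two
such errors are compensated by one more cell. *)
Definition balanced (t : n.-tuple pt) : Prop :=
  (forall i j, 0 <= tnth (tnth t i) j <= 1) /\
  forall k, (k < m ^ d)%N ->
    `|(count (fun x => snake_cell m x <= k)%N t)%:R - n%:R * snake_cdf k|
      < n%:R / (2 * (m ^ d)%:R).

Lemma measurable_snake_le k :
  measurable [set x : pt | (snake_cell m x <= k)%N].
Proof. exact: (@measurable_snake_cell _ _ m [set j | (j <= k)%N]). Qed.

Lemma snake_cdfE k :
  uniform_cube R d [set x | (snake_cell m x <= k)%N] = (snake_cdf k)%:E.
Proof. by rewrite fineK // fin_num_measure //; apply: measurable_snake_le. Qed.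

Lemma snake_cdf_incr k : (k.+1 < m ^ d)%N ->
  snake_cdf k + (m ^ d)%:R^-1 <= snake_cdf k.+1.
Proof.
move=> kM; rewrite -lee_fin EFinD -!snake_cdfE.
have -> : [set x : pt | (snake_cell m x <= k.+1)%N] =
    [set x | (snake_cell m x <= k)%N] `|` [set x | snake_cell m x = k.+1].
  apply/seteqP; split=> x /=; first by rewrite leq_eqVlt => /orP[/eqP|]; tauto.
  by case=> [|->] //; apply: leqW.
rewrite measureU.
- by apply: leeD => //; apply: uniform_cube_snake_cell.
- exact: measurable_snake_le.
- exact: (@measurable_snake_cell _ _ m [set k.+1]).
- by apply/seteqP; split=> x //= [xk e]; rewrite e ltnn in xk.
Qed.

Definition unbalanced_at k := [set t : n.-tuple pt |
  n%:R / (2 * (m ^ d)%:R) <=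
  `|(count (fun x => snake_cell m x <= k)%N t)%:R - n%:R * snake_cdf k|].

Lemma measurable_unbalanced_at k : measurable (unbalanced_at k).
Proof.
exact: (@measurable_count _ _ n (fun x => snake_cell m x <= k)%N
  [set j | n%:R / (2 * (m ^ d)%:R) <= `|j%:R - n%:R * snake_cdf k|]
  (measurable_snake_le k)).
Qed.

Definition in_cube := [set t : n.-tuple pt |
  forall i, [set x : pt | forall j, 0 <= tnth x j <= 1] (tnth t i)].

Lemma measurable_in_cube : measurable in_cube.
Proof. exact: (measurable_box (fun _ => @measurable_unit_cube R d)). Qed.

Lemma balancedE : [set t | balanced t] =
  in_cube `\` \big[setU/set0]_(k < m ^ d) unbalanced_at k.
Proof.
apply/seteqP; split=> t /=.
  move=> [t01 h]; split; first by [].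
  by rewrite -bigcup_mkord => -[k /= /h]; rewrite /unbalanced_at /= ltNge => /negP.
rewrite -bigcup_mkord => -[t01 h]; split; first by [].
by move=> k kM; rewrite ltNge; apply/negP => hk; apply: h; exists k.
Qed.

Lemma measurable_balanced : measurable [set t | balanced t].
Proof.
rewrite balancedE; apply: measurableD; first exact: measurable_in_cube.
by apply: bigsetU_measurable => k _; apply: measurable_unbalanced_at.
Qed.

(** The Chebyshev bound, with q (1 - q) <= 1/4. *)
Lemma unbalanced_at_prob k : (0 < m)%N -> (0 < n)%N ->
  (iid_prob (uniform_cube R d) n (unbalanced_at k) <=
    ((m ^ d)%:R ^+ 2 / n%:R)%:E)%E.
Proof.
move=> m0 n0; have nR : 0 < n%:R :> R by rewrite ltr0n.
have MR : 0 < (m ^ d)%:R :> R by rewrite ltr0n expn_gt0 m0.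
have L0 : 0 < n%:R / (2 * (m ^ d)%:R) :> R by rewrite divr_gt0 ?mulr_gt0.
apply: le_trans (chebyshev_count n (measurable_snake_le k) (snake_cdfE k) L0) _.
rewrite lee_fin.
set q := snake_cdf k; set M := (m ^ d)%:R in MR *.
rewrite ler_pdivrMr ?exprn_gt0 //.
have -> : M ^+ 2 / n%:R * (n%:R / (2 * M)) ^+ 2 = n%:R * 4^-1.
  by field; rewrite ?gt_eqF.
rewrite -mulrA ler_pM2l //; have := sqr_ge0 (q - 2^-1); nra.
Qed.

(** The cube has probability 1, and the m ^ d possible deviations are handled by a
union bound. *)
Lemma balanced_prob : (0 < m)%N -> (0 < n)%N ->
  ((1 - (m ^ d)%:R ^+ 3 / n%:R)%:E <=
   iid_prob (uniform_cube R d) n [set t | balanced t])%E.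
Proof.
move=> m0 n0; set P := iid_prob _ _.
have mU : measurable (\big[setU/set0]_(k < m ^ d) unbalanced_at k).
  by apply: bigsetU_measurable => k _; apply: measurable_unbalanced_at.
have cube1 : P in_cube = 1%E.
  rewrite /P /in_cube (iid_box _ _ (fun _ => @measurable_unit_cube R d)).
  by rewrite big1 // => i _; rewrite uniform_cube_unit.
have U_le : (P (\big[setU/set0]_(k < m ^ d) unbalanced_at k) <=
    ((m ^ d)%:R ^+ 3 / n%:R)%:E)%E.
  apply: le_trans (content_subadditive _ (fun k _ => measurable_unbalanced_at k)
    mU (@subset_refl _ _)) _.
  apply: (@le_trans _ _ (\sum_(k < m ^ d) ((m ^ d)%:R ^+ 2 / n%:R)%:E)%E).
    by apply: lee_sum => k _; apply: unbalanced_at_prob.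
  rewrite sumEFin lee_fin sumr_const card_ord.
  by rewrite -[leLHS]mulr_natl mulrA -exprS.
have : (P in_cube <= P [set t | balanced t] +
    P (\big[setU/set0]_(k < m ^ d) unbalanced_at k))%E.
  apply: le_trans (measureU2 P measurable_balanced mU).
  apply: le_measure; rewrite ?inE; first exact: measurable_in_cube.
    by apply: measurableU => //; apply: measurable_balanced.
  rewrite balancedE => t ct; case: (pselect ((\big[setU/set0]_(k < m ^ d) unbalanced_at k) t));
  [by right|by left].
rewrite cube1 EFinB => h.
rewrite leeBlDr //; apply: le_trans h _; exact: leeD.
Qed.

End good.

Section embedding.
Variables (R : realType) (d : nat) (n m : nat).
Local Notation pt := (Defs.point R d).

(** Matching by rank moves the number of a cell by at most 1, hence every coordinate
by at most 2 / m, and [dist_perturb] applies with e = 2 / m. *)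
Lemma balanced_contained (t t' : n.-tuple pt) (r : R) :
  (0 < d)%N -> (0 < m)%N -> 0 <= r -> balanced m t -> balanced m t' ->
  contained (geometric_graph r t) (geometric_graph (r + 4 * d%:R / m%:R) t').
Proof.
move=> d0 m0 r0 bt bt'; have [t01 _] := bt; have [t'01 _] := bt'.
have MR : 0 < (m ^ d)%:R :> R by rewrite ltr0n expn_gt0 m0.
have key (s s' : n.-tuple pt) : balanced m s -> balanced m s' ->
    forall k, (#|[pred i | snake_cell m (tnth s i) <= k]| <=
        #|[pred i | snake_cell m (tnth s' i) <= k.+1]|)%N.
  move=> [_ sb] [_ sb'] k; rewrite !(card_tnth_count (fun x => snake_cell m x <= _)%N).
  case: (ltnP k.+1 (m ^ d)) => kM; last first.
    rewrite [X in (_ <= X)%N](_ : _ = n); last first.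
      rewrite -[RHS](size_tuple s'); apply/eqP; rewrite -all_count.
      by apply/allP => x _; rewrite (leq_trans (ltnW (snake_cell_lt x m0))).
    by rewrite -[X in (_ <= X)%N](size_tuple s) count_size.
  have := sb k (ltnW kM); have := sb' _ kM; have := snake_cdf_incr R kM.
  rewrite -(ler_nat R) !ltr_norml.
  set c := _%:R; set c' := _%:R; set F := snake_cdf _ _ _ _; set F' := snake_cdf _ _ _ _.
  set L := _ / _ => FF /andP[h1 h2] /andP[h3 h4].
  have : n%:R * (F + (m ^ d)%:R^-1) <= n%:R * F' by rewrite ler_wpM2l.
  have -> : n%:R * (F + (m ^ d)%:R^-1) = n%:R * F + 2 * L.
    by rewrite /L; field; rewrite gt_eqF.
  lra.
have [f f_inj fP] := matching_exists (key _ _ bt bt') (key _ _ bt' bt).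
apply/containedP; exists f => // u v.
rewrite /adj /= !inE /= => /andP[uv dist]; rewrite (inj_eq f_inj) uv /=.
have close i : forall j, `|tnth (tnth t i) j - tnth (tnth t' (f i)) j| <= 2 / m%:R.
  by have [h1 h2] := fP i; apply: snake_cell_close.
have := dist_perturb d0 r0 (_ : 0 <= 2 / m%:R) (close u) (close v) dist.
by rewrite divr_ge0 // => /(_ isT)/le_trans; apply; rewrite lerD2l; lra.
Qed.

Lemma measurable_geometric_graph (r : R) (A : set (sgraph 'I_n)) : 0 <= r ->
  measurable (@geometric_graph R d n r @^-1` A).
Proof.
move=> r0; apply: measurable_fibers => G.
have -> : @geometric_graph R d n r @^-1` [set G] = [set t | [set f |
    f = [ffun e => e \in val G]]
      [ffun e : 'I_n * 'I_n => e \in geometric_edges r t]].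
  apply/seteqP; split=> t /=.
    by move=> <-; apply/ffunP => e; rewrite !ffunE.
  move=> /ffunP h; apply/val_inj/setP => e /=.
  by have := h e; rewrite !ffunE.
apply: (measurable_bool_family
  (p := fun e (t : n.-tuple pt) => e \in geometric_edges r t)) => e.
case: (eqVneq e.1 e.2) => e12.
  rewrite (_ : [set _ | _] = set0) //; apply/seteqP; split=> t //=.
  by rewrite inE e12 eqxx.
rewrite (_ : [set _ | _] = [set t : n.-tuple pt |
    euclidean_dist (tnth t e.1) (tnth t e.2) <= r]).
  exact: measurable_dist_le.
by apply/seteqP; split=> t /=; rewrite inE e12.
Qed.

End embedding.

(** * Containment of independent random graphs *)

Section events.
Context dT (T : measurableType dT) (R : realType) (P : probability T R).

Lemma measurable_graph_pair (U V : finType) (G : T -> sgraph U) (H : T -> sgraph V)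
    (B : sgraph U -> sgraph V -> Prop) :
  random_graph G -> random_graph H -> measurable [set w | B (G w) (H w)].
Proof.
move=> mG mH.
apply: (@measurable_fibers _ _ _ (fun w => (G w, H w)) _
  [set g | B g.1 g.2]) => -[g h].
rewrite (_ : _ @^-1` _ = G @^-1` [set g] `&` H @^-1` [set h]).
  by apply: measurableI; [apply: mG|apply: mH].
by apply/seteqP; split=> w /= [-> ->].
Qed.

(** The graphs of the balanced samples with radii r and r + 4 d / m form two sets A
and B such that every graph of A is contained in every graph of B, so that the
containment has probability at least P (G in A) P (G' in B). *)
Lemma contained_prob_ge d n m (r : R) (G G' : T -> sgraph 'I_n) :
  (0 < d)%N -> (0 < m)%N -> (0 < n)%N -> 0 <= r ->
  random_geometric_graph P d r G ->
  random_geometric_graph P d (r + 4 * d%:R / m%:R) G' ->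
  independent_graphs P G G' ->
  (m ^ d)%:R ^+ 3 / n%:R <= 1 :> R ->
  (((1 - (m ^ d)%:R ^+ 3 / n%:R) ^+ 2)%:E <=
    P [set w | contained (G w) (G' w)])%E.
Proof.
move=> d0 m0 n0 r0 [mG PG] [mG' PG'] ind small.
pose good := [set t : n.-tuple (Defs.point R d) | balanced m t].
have r'0 : 0 <= r + 4 * d%:R / m%:R by rewrite addr_ge0 // divr_ge0 // mulr_ge0.
pose A := geometric_graph r @` good.
pose B := geometric_graph (r + 4 * d%:R / m%:R) @` good.
have sub : G @^-1` A `&` G' @^-1` B `<=` [set w | contained (G w) (G' w)].
  move=> w [[t tg e] [t' tg' e']] /=; rewrite -e -e'.
  exact: (balanced_contained d0 m0).
have mAB : measurable (G @^-1` A `&` G' @^-1` B).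
  by apply: measurableI; [apply: mG|apply: mG'].
apply: (@le_trans _ _ (P (G @^-1` A `&` G' @^-1` B))); last first.
  by apply: le_measure => //; rewrite inE //; apply: measurable_graph_pair.
rewrite ind PG PG' expr2 EFinM.
have lo (s : R) : 0 <= s -> ((1 - (m ^ d)%:R ^+ 3 / n%:R)%:E <=
    iid_prob (uniform_cube R d) n
      (geometric_graph s @^-1` (geometric_graph s @` good)))%E.
  move=> s0; apply: le_trans (balanced_prob R d m0 n0) _.
  apply: le_measure; rewrite ?inE; first exact: measurable_balanced.
    exact: measurable_geometric_graph.
  by move=> t tg; exists t.
by apply: lee_pmul; rewrite ?lee_fin ?subr_ge0 //; apply: lo.
Qed.

End events.

(** * Bernoulli graphs *)

Lemma sum_subset_exp (R : comNzRingType) (I : finType) (x : R) (J : {set I}) :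
  \sum_(K : {set I}) (K \subset J)%:R * x ^+ #|K| = (1 + x) ^+ #|J|.
Proof.
have -> : (1 + x) ^+ #|J| = \prod_(i : I) ((if i \in J then x else 0) + 1).
  rewrite -prodr_const (big_mkcond (mem J)) /=; apply: eq_bigr => i _.
  by case: ifP => _; rewrite ?add0r // addrC.
rewrite bigA_distr; apply: eq_big => [K //|K _].
case: (boolP (K \subset J)) => KJ.
  rewrite mul1r -prodr_const [LHS]big_mkcond /=; apply: eq_bigr => i _.
  by case: ifP => // iK; rewrite (fintype.subsetP KJ).
have /subsetPn[i iK iJ] := KJ.
by rewrite mul0r (bigD1 i) //= iK (negbTE iJ) mul0r.
Qed.

(** Both sides are twice the binomial coefficient of n over 2, which is the sum of the
numbers j of pairs with larger element j. *)
Lemma card_vertex_pair n : (2 * #|{: vertex_pair n}| = n * n.-1)%N.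
Proof.
rewrite card_sig -[n.-1]bin1 mul_bin_diag; congr (2 * _)%N.
rewrite -sum1_card -bin2_sum big_mkord.
rewrite (eq_bigl (fun e : 'I_n * 'I_n => true && (e.1 < e.2)%N)); last first.
  by move=> e; rewrite inE.
rewrite -(pair_big_dep xpredT (fun i j : 'I_n => (i < j)%N) (fun _ _ => 1%N)) /=.
rewrite (exchange_big_dep xpredT) //=; apply: eq_bigr => j _.
rewrite sum1_card -[RHS]card_ord.
have w_inj : injective (widen_ord (ltnW (ltn_ord j))).
  by move=> a b /(congr1 val) /= /val_inj.
rewrite -(fintype.card_image w_inj); apply: eq_card => i; rewrite [LHS]unfold_in.
apply/idP/fintype.imageP => [ij|[k _ ->]] /=; last exact: ltn_ord k.
by exists (Ordinal ij) => //; apply: val_inj.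
Qed.

Section finite_laws.
Context dT (T : measurableType dT) (R : realType) (P : probability T R).

Lemma measure_fibers (V : finType) (g : T -> V) (A : set T) :
  (forall B : set V, measurable (g @^-1` B)) -> measurable A ->
  P A = (\sum_(v : V) P (A `&` g @^-1` [set v]))%E.
Proof.
move=> mg mA; rewrite fsbig_seq ?index_enum_uniq //.
rewrite -measure_fin_bigcup.
- congr (P _); apply/seteqP; split=> [w Aw|w [v _ []]] //.
  by exists (g w) => //=; rewrite mem_index_enum.
- exact: finite_seq.
- by move=> u v _ _ [w [[_ /= <-] [_ /= <-]]].
- by move=> v _; apply: measurableI => //; apply: mg.
Qed.

Lemma union_bound (I : finType) (A : set T) (F : I -> set T) :
  measurable A -> (forall i, measurable (F i)) ->
  A `<=` \bigcup_i F i -> (P A <= \sum_(i : I) P (F i))%E.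
Proof.
move=> mA mF AF; rewrite fsbig_seq ?index_enum_uniq //.
apply: content_sub_fsum => //.
by move=> w /AF[i _ Fi]; exists i => //=; rewrite mem_index_enum.
Qed.

End finite_laws.

Section bernoulli.
Context dT (T : measurableType dT) (R : realType) (P : probability T R) (n : nat).
Implicit Types (G : T -> sgraph 'I_n) (g : sgraph 'I_n) (K : {set vertex_pair n}).

Definition edges g : {set vertex_pair n} :=
  [set e | adj g (val e).1 (val e).2]%SET.

Lemma bernoulli_subset_prob G (p : R) K : bernoulli_graph P p G ->
  P [set w | K \subset edges (G w)] = (p ^+ #|K|)%:E.
Proof.
move=> [mG Gp ind].
rewrite (_ : [set _ | _] = \bigcap_(e in [set` K])
  [set w | adj (G w) (val e).1 (val e).2]).
  rewrite ind (eq_bigr (fun=> p%:E)) // prodEFin.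
  by rewrite prodr_const.
apply/seteqP; split=> w /= h.
  by move=> e /= eK; have := fintype.subsetP h _ eK; rewrite inE.
by apply/fintype.subsetP => e eK; rewrite inE; apply: h.
Qed.

(** The edges are indexed by increasing pairs, whose image under [f] may have to be
reversed. *)
Lemma ordered_image (f : 'I_n -> 'I_n) : injective f ->
  exists2 phi : vertex_pair n -> vertex_pair n, injective phi &
    forall g e, adj g (val (phi e)).1 (val (phi e)).2 =
      adj g (f (val e).1) (f (val e).2).
Proof.
move=> f_inj.
have ex (e : vertex_pair n) : exists e' : vertex_pair n,
    val e' = (f (val e).1, f (val e).2) \/ val e' = (f (val e).2, f (val e).1).
  case: e => -[a b] /= ab; case: (ltngtP (f a) (f b)) => h.
  - by exists (exist _ (f a, f b) h); left.
  - by exists (exist _ (f b, f a) h); right.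
  - by move/val_inj/f_inj: h ab => ->; rewrite ltnn.
have [phi phiP] := choice ex; exists phi.
  move=> e1 e2 e12; apply: val_inj; have := phiP e1; have := phiP e2.
  rewrite e12; case: (val (phi e2)) => x y.
  case: e1 e2 {e12} => -[a b] /= ab [[c d] /= cd].
  by move=> [][-> ->] [][/f_inj e /f_inj e'];
    move: ab cd; rewrite ?e ?e' // => h1 h2; have := ltn_trans h1 h2; rewrite ltnn.
by move=> g e; case: (phiP e) => -> //=; rewrite adj_sym.
Qed.

Lemma bernoulli_image_prob G' (p : R) (f : 'I_n -> 'I_n) g :
  injective f -> bernoulli_graph P p G' ->
  P [set w | forall u v, adj g u v -> adj (G' w) (f u) (f v)] =
    (p ^+ #|edges g|)%:E.
Proof.
move=> f_inj G'p; have [phi phi_inj phiE] := ordered_image f_inj.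
rewrite -(card_imset _ phi_inj) -(bernoulli_subset_prob _ G'p); congr (P _).
apply/seteqP; split=> w /= h.
  apply/fintype.subsetP => _ /imsetP[e eg ->]; rewrite inE phiE; apply: h.
  by rewrite inE in eg.
have fwd (e : vertex_pair n) : adj g (val e).1 (val e).2 ->
    adj (G' w) (f (val e).1) (f (val e).2).
  move=> eg; rewrite -phiE.
  by have := fintype.subsetP h (phi e); rewrite inE; apply; apply: imset_f; rewrite inE.
move=> u v uv; case: (ltngtP u v) => h'.
- exact: (fwd (exist _ (u, v) h')).
- by rewrite adj_sym; apply: (fwd (exist _ (v, u) h')) => /=; rewrite adj_sym.
- by move: uv; rewrite (val_inj h') adj_irr.
Qed.

(** Conditioning on G = g gives the sum over g of P (G = g) q ^ |J|, where J is the
edge set of g. Writing q = 1 + (q - 1), expanding q ^ |J| over the subsets K of J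
and exchanging the sums leaves the sum over all K of
(q - 1) ^ |K| P (K is a set of edges of G) = ((q - 1) p) ^ |K|, which is again a
binomial expansion. *)
Lemma hom_prob G G' (p q : R) (f : 'I_n -> 'I_n) : injective f ->
  bernoulli_graph P p G -> bernoulli_graph P q G' -> independent_graphs P G G' ->
  P [set w | forall u v, adj (G w) u v -> adj (G' w) (f u) (f v)] =
    ((1 - p * (1 - q)) ^+ #|{: vertex_pair n}|)%:E.
Proof.
move=> f_inj Gp G'q ind; have [mG _ _] := Gp; have [mG' _ _] := G'q.
set E := [set w | _].
have mE : measurable E.
  exact: (measurable_graph_pair
    (fun g h => forall u v, adj g u v -> adj h (f u) (f v)) mG mG').
pose a g := fine (P (G @^-1` [set g])).
have aE g : P (G @^-1` [set g]) = (a g)%:E.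
  by rewrite fineK // fin_num_measure //; apply: mG.
have PE : P E = (\sum_g a g * q ^+ #|edges g|)%:E.
  rewrite (measure_fibers P mG mE) -sumEFin; apply: eq_bigr => g _.
  pose B := [set h : sgraph 'I_n | forall u v, adj g u v -> adj h (f u) (f v)].
  rewrite EFinM -aE -(bernoulli_image_prob g f_inj G'q).
  rewrite -(ind [set g] B); congr (P _).
  by apply/seteqP; split=> w /= [h1 h2]; subst; split.
have subE K : \sum_g a g * (K \subset edges g)%:R = p ^+ #|K|.
  apply: EFin_inj; rewrite -(bernoulli_subset_prob K Gp).
  rewrite [RHS](measure_fibers P mG); last exact: (mG [set g | K \subset edges g]).
  rewrite -sumEFin; apply: eq_bigr => g _.
  case: (boolP (K \subset edges g)) => Kg.
    rewrite mulr1 -aE; congr (P _); apply/seteqP; split=> w /=; last by case.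
    by move=> gw; rewrite gw.
  rewrite mulr0 (_ : _ `&` _ = set0) ?measure0 //.
  by apply/seteqP; split=> w //= [+ gw]; rewrite gw (negbTE Kg).
rewrite PE; congr EFin.
under eq_bigr => g _.
  rewrite -{1}[q](subrK 1) addrC -sum_subset_exp mulr_sumr; over.
rewrite exchange_big /=.
under eq_bigr => K _.
  under eq_bigr => g _ do rewrite mulrA.
  rewrite -mulr_suml subE -exprMn; over.
have -> : 1 - p * (1 - q) = 1 + p * (q - 1) by ring.
rewrite -cardsT -sum_subset_exp; apply: eq_bigr => K _.
by rewrite finset.subsetT mul1r.
Qed.

(** The union bound over the n! permutations of the vertices. *)
Lemma contained_prob_le G G' (p q : R) :
  bernoulli_graph P p G -> bernoulli_graph P q G' -> independent_graphs P G G' ->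
  (P [set w | contained (G w) (G' w)] <=
    (n`!%:R * (1 - p * (1 - q)) ^+ #|{: vertex_pair n}|)%:E)%E.
Proof.
move=> Gp G'q ind; have [mG _ _] := Gp; have [mG' _ _] := G'q.
pose E (s : {perm 'I_n}) :=
  [set w | forall u v, adj (G w) u v -> adj (G' w) (s u) (s v)].
have mE s : measurable (E s).
  exact: (measurable_graph_pair
    (fun g h => forall u v, adj g u v -> adj h (s u) (s v)) mG mG').
apply: (@le_trans _ _ (\sum_s P (E s))%E).
  apply: union_bound => //; first exact: measurable_graph_pair.
  move=> w /containedP[f f_inj fP]; exists (perm f_inj) => // u v /fP.
  by rewrite !permE.
rewrite (eq_bigr (fun=> ((1 - p * (1 - q)) ^+ #|{: vertex_pair n}|)%:E)).
  rewrite sumEFin lee_fin sumr_const -[leLHS]mulr_natl.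
  by rewrite card_Sn.
by move=> s _; apply: (hom_prob _ Gp G'q ind); apply: perm_inj.
Qed.

Lemma contained_prob_le_expR G G' :
  bernoulli_graph P (1 / 4) G -> bernoulli_graph P (3 / 4) G' ->
  independent_graphs P G G' ->
  (P [set w | contained (G w) (G' w)] <=
    (n`!%:R * expR (- (n%:R * (n%:R - 1) / 32)))%:E)%E.
Proof.
move=> G1 G3 ind; apply: le_trans (contained_prob_le G1 G3 ind) _.
rewrite lee_fin ler_wpM2l //.
set N := #|_|.
have -> : - (n%:R * (n%:R - 1) / 32) = N%:R * (- 16^-1) :> R.
  have := congr1 (fun k : nat => k%:R : R) (card_vertex_pair n).
  rewrite -/N !natrM => h.
  have -> : n%:R * (n%:R - 1) = 2 * N%:R :> R.
    by rewrite h; case: (n) => [|k] /=; rewrite ?mul0r // -natr1 addrK.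
  by field.
rewrite expRM_natl; apply: lerXn2r; rewrite ?nnegrE ?expR_ge0 //; first by lra.
by apply: le_trans (expR_ge1Dx _); lra.
Qed.

End bernoulli.

(** * Asymptotics *)

Lemma integer_root (e : nat) : (0 < e)%N -> exists m : nat -> nat,
  forall n, (m n ^ e <= n)%N /\ forall k, (k ^ e <= n)%N -> (k <= m n)%N.
Proof.
move=> e0.
have root n : exists m, (m ^ e <= n)%N /\ forall k, (k ^ e <= n)%N -> (k <= m)%N.
  have ex : exists k, (k ^ e <= n)%N by exists 0%N; rewrite exp0n.
  have bound k : (k ^ e <= n)%N -> (k <= n)%N.
    by apply: leq_trans; case: k => // k; rewrite -{1}(expn1 k.+1) leq_pexp2l //.
  by have [m h1 h2] := ex_maxnP ex bound; exists m.
by have [m mP] := choice root; exists m.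
Qed.

Lemma invr_cvg0 (R : realType) (m : nat -> nat) :
  (forall k, \forall n \near \oo, (k <= m n)%N) ->
  (m n)%:R^-1 @[n --> \oo] --> (0 : R).
Proof.
move=> m_oo; apply/cvgrPdist_le => e e0.
near=> n.
have : ((Num.truncn e^-1).+1 <= m n)%N by near: n; exact: m_oo.
rewrite -(ler_nat R) => h.
have h' : e^-1 <= (m n)%:R.
  rewrite (le_trans _ h) // ltW //.
  have ei : 0 <= e^-1 by rewrite invr_ge0 ltW.
  by have /andP[] := truncn_itv ei.
rewrite sub0r normrN ger0_norm ?invr_ge0 // -[leRHS]invrK lef_pV2 ?posrE ?invr_gt0 //.
by rewrite (lt_le_trans _ h') ?invr_gt0.
Unshelve. all: by end_near.
Qed.

Lemma fact_le_expn n : (n`! <= n ^ n)%N.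
Proof.
elim: n => // n IH; rewrite factS expnS leq_mul2l /= (leq_trans IH) //.
by case: n {IH} => // n; rewrite leq_exp2r.
Qed.

(** The left-hand side is at most b ^ n with b = n exp (- (n - 1) / 32). As
exp (y) >= 1 + y, with y = (n - 1) / 64 one has exp (2 y) >= (n / 64) ^ 2, whence
b <= 4096 / n; and b ^ n <= b as soon as b <= 1. *)
Lemma bernoulli_bound_le (R : realType) n : (4096 <= n)%N ->
  n`!%:R * expR (- (n%:R * (n%:R - 1) / 32)) <= 4096 * n%:R^-1 :> R.
Proof.
move=> n4; have n0 : (0 < n)%N by lia.
have nR : 0 < n%:R :> R by rewrite ltr0n.
pose y : R := (n%:R - 1) / 64.
have base : n%:R * expR (- (2 * y)) <= 4096 * n%:R^-1.
  rewrite expRN ler_pdivrMr ?expR_gt0 // -mulrA mulrC -mulrA ler_pdivlMl //.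
  have : n%:R / 64 <= expR y.
    by apply: le_trans (expR_ge1Dx y); rewrite /y; lra.
  rewrite -ler_sqr ?nnegrE ?expR_ge0 ?divr_ge0 // -expRM_natl.
  nra.
have -> : - (n%:R * (n%:R - 1) / 32) = n%:R * (- (2 * y)) :> R by rewrite /y; field.
rewrite expRM_natl.
apply: (@le_trans _ _ ((n%:R * expR (- (2 * y))) ^+ n)).
  rewrite exprMn ler_wpM2r ?exprn_ge0 ?expR_ge0 // -natrX ler_nat.
  exact: fact_le_expn.
have base1 : n%:R * expR (- (2 * y)) <= 1.
  by apply: le_trans base _; rewrite ler_pdivrMr // mul1r ler_nat.
by apply: le_trans base; apply: ler_iXnr; rewrite ?n0 ?mulr_ge0 ?expR_ge0.
Qed.

Theorem mainTheorem3 (R : realType) :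
  (forall d : nat, (1 <= d)%N ->
    exists eta : nat -> R,
      [/\ forall n, 0 <= eta n,
          eta @ \oo --> (0 : R)
        & forall r : nat -> R, (forall n, 0 < r n) ->
          forall (disp : nat -> measure_display)
                 (T : forall n, measurableType (disp n))
                 (P : forall n, probability (T n) R)
                 (G G' : forall n, T n -> sgraph 'I_n),
            (forall n, random_geometric_graph (P n) d (r n) (G n)) ->
            (forall n, random_geometric_graph (P n) d (r n + eta n) (G' n)) ->
            (forall n, independent_graphs (P n) (G n) (G' n)) ->
            (fun n => P n [set w | contained (G n w) (G' n w)]) @ \oo
              --> 1%E])
  /\
  (forall (n : nat) (disp : measure_display) (T : measurableType disp)
          (P : probability T R) (G G' : T -> sgraph 'I_n),
      bernoulli_graph P (1 / 4) G ->
      bernoulli_graph P (3 / 4) G' ->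
      independent_graphs P G G' ->
      (P [set w | contained (G w) (G' w)] <=
        (n`!%:R * expR (- (n%:R * (n%:R - 1) / 32)))%:E)%E)
  /\
  (forall (disp : nat -> measure_display)
          (T : forall n, measurableType (disp n))
          (P : forall n, probability (T n) R)
          (G G' : forall n, T n -> sgraph 'I_n),
      (forall n, bernoulli_graph (P n) (1 / 4) (G n)) ->
      (forall n, bernoulli_graph (P n) (3 / 4) (G' n)) ->
      (forall n, independent_graphs (P n) (G n) (G' n)) ->
      (fun n => P n [set w | contained (G n w) (G' n w)]) @ \oo --> 0%E).
Proof.
split; last split.
- move=> d d0.
  (* The exponent 3 d + 1 makes the bound (m ^ d) ^ 3 / n at most 1 / m. *)
  have [m mP] := @integer_root (d * 3).+1 isT.
  have m_oo k : \forall n \near \oo, (k <= m n)%N.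
    near=> n; have [_] := mP n; apply.
    by near: n; exact: nbhs_infty_ge.
  have minv : (m n)%:R^-1 @[n --> \oo] --> (0 : R) := invr_cvg0 m_oo.
  exists (fun n => 4 * d%:R / (m n)%:R); split.
  + by move=> n; rewrite divr_ge0 // mulr_ge0.
  + by rewrite -(mulr0 (4 * d%:R)); apply: cvgM => //; apply: cvg_cst.
  move=> r r0 disp T P G G' GP G'P ind.
  apply: (@squeeze_cvge _ _ _ _ (fun n => ((1 - (m n)%:R^-1) ^+ 2)%:E) _ (cst 1%E)).
  + near=> n; have n0 : (0 < n)%N by near: n; exact: nbhs_infty_gt.
    have m0 : (0 < m n)%N by near: n; exact: m_oo.
    have mR : 0 < (m n)%:R :> R by rewrite ltr0n.
    have nR : 0 < n%:R :> R by rewrite ltr0n.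
    have small : (m n ^ d)%:R ^+ 3 / n%:R <= (m n)%:R^-1 :> R.
      have [+ _] := mP n; rewrite -(ler_nat R) natrX exprSr natrX -exprM => h.
      by rewrite ler_pdivrMr // mulrC ler_pdivlMr.
    have m1 : (m n)%:R^-1 <= 1 :> R by rewrite invf_le1 // ler1n.
    apply/andP; split; last first.
      apply: probability_le1; apply: measurable_graph_pair.
        by have [] := GP n.
      by have [] := G'P n.
    have := contained_prob_ge d0 m0 n0 (ltW (r0 n)) (GP n) (G'P n) (ind n)
      (le_trans small m1).
    apply: le_trans; rewrite lee_fin lerXn2r ?nnegrE ?subr_ge0 //.
      exact: le_trans small m1.
    by rewrite lerD2l lerN2.
  + apply: cvg_EFin; first exact: nearW.
    have h : 1 - (m n)%:R^-1 @[n --> \oo] --> (1 : R).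
      by rewrite -[X in _ --> X]subr0; apply: cvgB => //; apply: cvg_cst.
    by rewrite -[X in _ --> X]mulr1; exact: (cvgM h h).
  + exact: cvg_cst.
- by move=> n disp T P G G'; apply: contained_prob_le_expR.
move=> disp T P G G' G1 G3 ind.
apply: (@squeeze_cvge _ _ _ _ (cst 0%E) _ (fun n => (4096 * n%:R^-1)%:E)).
- near=> n; rewrite measure_ge0 /=.
  apply: le_trans (contained_prob_le_expR (G1 n) (G3 n) (ind n)) _.
  rewrite lee_fin; apply: bernoulli_bound_le.
  by near: n; exact: nbhs_infty_ge.
- exact: cvg_cst.
apply: cvg_EFin; first exact: nearW.
rewrite -(mulr0 4096); apply: cvgM; first exact: cvg_cst.
by apply: (@invr_cvg0 R id) => k; exact: nbhs_infty_ge.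
Unshelve. all: by end_near.
Qed.
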